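(* Let $W:[0,1]^2\to[0,1]$ be continuous and symmetric, let $\eta\in C([0,1];\mathbb{R})$, let $f:\mathbb{R}\to\mathbb{R}$ be Lipschitz and $2\pi$-periodic, and let $D:\mathbb{R}\to\mathbb{R}$ be Lipschitz and $2\pi$-periodic with $\max_{\theta\in\mathbb{R}}|D(\theta)|=1$. Let $(\alpha_n)_{n\ge1}$ be a sequence with $0<\alpha_n\le 1$ and $\frac{\log(n)/n}{\alpha_n^3}\to0$ as $n\to\infty$. Let $\theta(t,x)$ be the solution of the continuum dynamical system (CDS) with initial condition $\eta$, and let $\theta^n(t,x)$ be the piecewise constant interpolant of the solution of the sampled dynamical system (SDS) of size $n$ with initial condition $\theta^n_i(0)=\eta\left(\frac{i-1}{n}\right)$. Then for any fixed $\delta,\epsilon,T>0$ there exists $\bar n\in\mathbb{N}$ such that for each $n>\bar n$, with probability at least $1-\delta$, $$\|\theta^n(t,\cdot)-\theta(t,\cdot)\|_{L^\infty([0,1])}<\epsilon\quad\text{for all }t\in[0,T].$$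
   Context: Write $I=[0,1]$ and $I_i^{(n)}=\left[\frac{i-1}{n},\frac{i}{n}\right)$ for $1\le i\le n$. (CDS): $\theta:[0,\infty)\times I\to\mathbb{R}$ is the unique (jointly continuous in $(t,x)$, with $\partial_t\theta$ continuous) global-in-time solution of $\partial_t\theta(t,x)=f(\theta(t,x))+\int_I W(x,y)D(\theta(t,y)-\theta(t,x))\,dy$ for $x\in I$, with $\theta(0,x)=\eta(x)$. $W$-random network: $W^{(n)}_{ij}=n^2\int_{I_i^{(n)}\times I_j^{(n)}}W(x,y)\,dx\,dy$, and $A^{(n)}$ is a random symmetric $n\times n$ matrix with entries in $\{0,1\}$ such that $A^{(n)}_{ij}=A^{(n)}_{ji}$ is a Bernoulli random variable with success probability $\alpha_nW^{(n)}_{ij}$, the entries with $1\le i\le j\le n$ being independent. (SDS): for $i=1,\dots,n$, $\dot\theta^n_i(t)=f(\theta^n_i(t))+\frac{1}{n\alpha_n}\sum_{j=1}^nA^{(n)}_{ij}D(\theta^n_j(t)-\theta^n_i(t))$. Interpolant: $\theta^n(t,x)=\sum_{i=1}^n\theta^n_i(t)\mathbf{1}_{[\frac{i-1}{n},\frac{i}{n})}(x)$. The norm $\|\cdot\|_{L^\infty(I)}$ is the essential supremum norm on $I$. *)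

(* Defs.v *)
From HB Require Import structures.
From mathcomp Require Import all_boot all_order all_algebra.
From mathcomp Require Import all_classical all_reals all_analysis.

Set Implicit Arguments.
Unset Strict Implicit.
Unset Printing Implicit Defensive.

Import Order.TTheory GRing.Theory Num.Theory.
Import numFieldNormedType.Exports.

Local Open Scope classical_set_scope.
Local Open Scope ring_scope.

Definition unit_itv {R : realType} : set R := `[0, 1]%classic.

Definition half_line {R : realType} : set R := `[0, +oo[%classic.

(* The derivative of u at t relative to A: the difference quotient only looks
   at points of A, so that on the half line the derivative at the time 0 is the
   right derivative. *)
Definition has_derivative_in {R : realType} (A : set R) (u : R -> R)
    (t l : R) : Prop :=
  (s - t)^-1 * (u s - u t) @[s --> within A t^'] --> l.

(* theta t x is only constrained for t in the half line and x in the unit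
   interval. *)
Definition CDS_solution {R : realType} (W : R * R -> R) (f D eta : R -> R)
    (theta : R -> R -> R) : Prop :=
  [/\ {within half_line `*` unit_itv,
         continuous (fun p : R * R => theta p.1 p.2)},
      forall x, unit_itv x -> theta 0 x = eta x
    & exists dtheta : R -> R -> R,
        {within half_line `*` unit_itv,
           continuous (fun p : R * R => dtheta p.1 p.2)} /\
        forall t x, half_line t -> unit_itv x ->
          has_derivative_in half_line (theta ^~ x) t (dtheta t x) /\
          dtheta t x = f (theta t x) +
            \int[lebesgue_measure]_(y in unit_itv)
              (W (x, y) * D (theta t y - theta t x))].

(* Indices are shifted: i : 'I_n stands for the vertex i + 1. *)
Definition cell {R : realType} (n : nat) (i : 'I_n) : set R :=
  `[i%:R / n%:R, i.+1%:R / n%:R[%classic.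

Definition cell_average {R : realType} (W : R * R -> R) (n : nat)
    (i j : 'I_n) : R :=
  n%:R ^+ 2 *
  \int[(lebesgue_measure \x lebesgue_measure)%E]_(p in cell i `*` cell j) W p.

Definition mutually_independent {d d'} {Omega : measurableType d}
    {S : measurableType d'} {R : realType} (P : probability Omega R)
    (I : finType) (K : {set I}) (X : I -> {RV P >-> S}) : Prop :=
  forall (J : {set I}) (B : I -> set S), J \subset K ->
    (forall i, measurable (B i)) ->
    P (\bigcap_(i in [set` J]) (X i @^-1` B i)) =
    (\prod_(i in J) P (X i @^-1` B i))%E.

(* The entries 0 and 1 of the adjacency matrix are encoded as booleans. *)
Definition W_random_network {d} {Omega : measurableType d} {R : realType}
    (P : probability Omega R) (W : R * R -> R) (n : nat) (alpha : R)
    (A : 'I_n -> 'I_n -> {RV P >-> bool}) : Prop :=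
  [/\ forall i j w, A i j w = A j i w,
      forall i j, distribution P (A i j) =
                  bernoulli_prob (alpha * cell_average W i j)
    & mutually_independent [set ij : 'I_n * 'I_n | (ij.1 <= ij.2)%N]
        (fun ij => A ij.1 ij.2)].

Definition SDS_solution {R : realType} (n : nat) (alpha : R)
    (a : 'I_n -> 'I_n -> bool) (f D eta : R -> R)
    (u : R -> 'I_n -> R) : Prop :=
  (forall i, u 0 i = eta (i%:R / n%:R)) /\
  forall t i, half_line t ->
    has_derivative_in half_line (u ^~ i) t
      (f (u t i) +
       (n%:R * alpha)^-1 * \sum_(j < n) (a i j)%:R * D (u t j - u t i)).

Definition interpolant {R : realType} (n : nat) (u : 'I_n -> R) (x : R) : R :=
  \sum_(i < n) u i * \1_(cell i) x.

Lemma measurable_unit_itv {R : realType} : measurable (@unit_itv R).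
Proof. exact: measurable_itv. Qed.

Definition Linfty_unit_norm {R : realType} (g : R -> R) : \bar R :=
  ('N[mrestr lebesgue_measure (@measurable_unit_itv R)]_(+oo)
     [EFin \o g])%E.

(* Main.v *)
Require Import Defs.
From HB Require Import structures.
From mathcomp Require Import all_boot all_order all_algebra.
From mathcomp Require Import all_classical all_reals all_analysis.
From mathcomp Require Import ess_sup_inf.
From mathcomp Require Import ring lra.
Set Implicit Arguments.
Unset Strict Implicit.
Unset Printing Implicit Defensive.
Import Order.TTheory GRing.Theory Num.Theory.
Import numFieldNormedType.Exports.
Local Open Scope classical_set_scope.
Local Open Scope ring_scope.

(** The continuum solution sampled at the left endpoints x_i of the cells
satisfies the sampled system up to a small error, and this error is uniform in
time with high probability.  The point is that the comparison freezes the
deterministic trajectory theta (t, x_j), not the random one: the term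
(1 / (n alpha)) sum_j (A_ij - alpha W_ij) D (theta (t, x_j) - theta (t, x_i))
is then, for a fixed time t, a sum of independent centred bounded variables.

The exponential moment method gives each such sum a tail of order
exp (- n alpha s^2 / 8) at the level s n alpha ([bernoulli_chernoff]), and a
union bound over the n rows and over a finite grid of times costs only a factor
of order n ([network_deviation]).  Since log n / (n alpha^3) tends to 0, n alpha
dominates log n and the total failure probability vanishes
([chernoff_tail_vanishes]).  The constant coefficients 1 are included in the
union bound; they bound all degrees by 2 n alpha, and this makes the random
vector field Lipschitz with a constant that does not depend on n.

On the resulting event everything is deterministic.  Uniform continuity of theta
passes from the grid to all times, and together with the uniform continuity of W
it compares the averaged sum with the integral of the continuum equation
([vector_field_consistency]).  A Gronwall inequality in the maximum norm over the
nodes ([gronwall_sup]) bounds the distance at the nodes, and uniform continuity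
of theta in x extends the bound to the cells.

Measurability of the event of the theorem is a finite matter: by uniqueness of
the solutions, which is again Gronwall, the event depends on the adjacency matrix
only ([SDS_solution_unique], [measurable_of_bool_family]). *)

(** * One-sided derivatives and a Gronwall inequality *)

Lemma has_derivative_in_continuous (R : realType) (A : set R) (u : R -> R)
    (t l : R) :
  has_derivative_in A u t l -> u s @[s --> within A (nbhs t)] --> u t.
Proof.
have FF : Filter (within A t^') by exact: within_filter.
move=> dul; have At0 : (fun s => s - t) s @[s --> within A t^'] --> 0.
  rewrite -(subrr t); apply: cvgB; last exact: cvg_cst.
  by move=> B /nbhs_dnbhs; apply: cvg_within.
have ut : u s @[s --> within A t^'] --> u t.
  have : (s - t) * ((s - t)^-1 * (u s - u t)) + u t @[s --> within A t^'] -->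
      0 * l + u t.
    by apply: cvgD; [exact: cvgM|exact: cvg_cst].
  rewrite mul0r add0r => H; refine (cvg_trans (near_eq_cvg _) H).
  rewrite near_withinE near_withinE; near=> s => st _ /=.
  by rewrite mulrA mulfV ?mul1r ?subrK// subr_eq0.
move=> B Bu.
have Bu' : \forall s \near t, s != t -> A s -> B (u s) := ut _ Bu.
change (\forall s \near t, A s -> B (u s)); near=> s => As.
have [->|st] := eqVneq s t; first exact: nbhs_singleton.
by apply: (near Bu').
Unshelve. all: by end_near.
Qed.

Lemma has_derivative_in_is_derive (R : realType) (A : set R) (u : R -> R)
    (t l : R) :
  A° t -> has_derivative_in A u t l -> is_derive t 1 u l.
Proof.
move=> At dul.
have sh : (fun h : R => h *: 1 + t) h @[h --> 0^'] --> within A t^'.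
  move=> B Bt.
  have Bt' : \forall s \near t, s != t -> A s -> B s := Bt.
  change (\forall h \near (0 : R), h != 0 -> B (h *: 1 + t)).
  have cs : h *: 1 + t @[h --> (0 : R)] --> t.
    rewrite -[X in _ --> X]add0r; apply: cvgD; last exact: cvg_cst.
    by rewrite -[X in _ --> X](scale0r (1 : R)); apply: cvgZr_tmp; exact: cvg_id.
  have Bs := cs _ Bt'; have As := cs _ At.
  near=> h => h0.
  have Bh : h *: 1 + t != t -> A (h *: 1 + t) -> B (h *: 1 + t) by near: h.
  have Ah : A (h *: 1 + t) by near: h.
  by apply: Bh Ah; rewrite -subr_eq0 addrK scaler_eq0 oner_eq0 orbF.
have cvl : h^-1 *: (u (h *: 1 + t) - u t) @[h --> 0^'] --> l.
  refine (cvg_trans (near_eq_cvg _) (cvg_comp _ _ sh dul)).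
  by near=> h; rewrite /= addrK /GRing.scale /= mulr1.
apply: DeriveDef; first by apply/cvg_ex; exists l.
exact/cvg_lim.
Unshelve. all: by end_near.
Qed.

(** A Gronwall inequality for the maximum of finitely many functions, proved
without differentiating the maximum.  With the weight exp (- 2 C t) the maximum S
of all |e i| is attained at some time and index; there the hypothesis on the
derivatives only gives S / 2 + kappa T, hence S <= 2 kappa T. *)
Lemma gronwall_sup (R : realType) (I : finType) (T C kappa : R)
    (e de : R -> I -> R) :
  0 < C -> 0 <= kappa ->
  (forall i, {within `[0, T], continuous (e ^~ i)}) ->
  (forall (t : R) i, 0 < t < T -> is_derive t 1 (e ^~ i) (de t i)) ->
  (forall i, e 0 i = 0) ->
  (forall (t : R) i (m : R), 0 < t < T -> (forall j, `|e t j| <= m) ->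
     `|de t i| <= C * m + kappa) ->
  forall (t : R) i, 0 <= t <= T -> `|e t i| <= 2 * kappa * T * expR (2 * C * T).
Proof.
move=> C0 k0 ec ed e0 bde t0 i0 t0T.
have T0 : 0 <= T by case/andP: t0T; exact: le_trans.
have clin k : continuous (fun t : R => k * t).
  by move=> x; apply: cvgM; [exact: cvg_cst|exact: cvg_id].
have cexp k : continuous (fun t : R => expR (k * t)).
  by move=> x; apply: (continuous_comp (clin k x)); exact: continuous_expR.
pose g i (t : R) : R := `|e t i| * expR (- (2 * C) * t).
have gmax i : exists2 c, c \in `[0, T] & forall t, t \in `[0, T] -> g i t <= g i c.
  apply: EVT_max => // x; apply: cvgM; last exact/continuous_subspaceT.
  by apply: cvg_norm; exact: ec.
have {gmax} [c cT gc] : exists2 c : I -> R, (forall i, 0 <= c i <= T) &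
    forall i t, 0 <= t <= T -> g i t <= g i (c i).
  have /choice[c H] : forall i, exists c, 0 <= c <= T /\
      forall t, 0 <= t <= T -> g i t <= g i c.
    move=> i; have [c + H] := gmax i; rewrite in_itv/= => cT.
    by exists c; split => // t tT; apply: H; rewrite in_itv.
  by exists c => i; have [] := H i.
have [i1 _ i1max] := @arg_maxP _ _ _ i0 xpredT (fun i => g i (c i)) erefl.
set S : R := g i1 (c i1) in i1max.
have S0 : 0 <= S by rewrite /S /g mulr_ge0 ?expR_ge0.
have leS t i : 0 <= t <= T -> `|e t i| <= S * expR (2 * C * t).
  move=> tT; have := le_trans (gc i t tT) (i1max i isT).
  by rewrite /g mulNr expRN ler_pdivrMr ?expR_gt0.
(* b bounds the growth of |e i|: its derivative is the hypothesis on de with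
   the weighted bound leS in place of m. *)
pose b (t : R) : R := S / 2 * expR (2 * C * t) + kappa * t.
pose s : R := Num.sg (e (c i1) i1).
pose G (t : R) : R := s * e t i1 - b t.
have sle1 : `|s| <= 1 by rewrite /s normr_sg; case: (_ == _).
have GD t : 0 < t < T -> is_derive t 1 G (s * de t i1 -
   (S * C * expR (2 * C * t) + kappa)).
  move=> tT; have ? := ed t i1 tT.
  have d1 : is_derive t 1 (fun t => s * e t i1) (s * de t i1).
    exact: (@is_deriveZ _ _ _ (e ^~ i1) s).
  have d2 : is_derive t 1 (fun t : R => 2 * C * t) (2 * C).
    by have := @is_deriveZ _ _ _ id (2 * C) t 1 _ (is_derive_id _ _);
      rewrite /GRing.scale /= mulr1.
  have d3 : is_derive t 1 (fun t => expR (2 * C * t)) (2 * C * expR (2 * C * t)).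
    rewrite [_ * expR _]mulrC; exact: (is_derive1_comp (is_derive_expR (2 * C * t)) d2).
  have d4 : is_derive t 1 (fun t => S / 2 * expR (2 * C * t))
      (S / 2 * (2 * C * expR (2 * C * t))).
    exact: (@is_deriveZ _ _ _ (fun t => expR (2 * C * t))).
  have d5 : is_derive t 1 (fun t : R => kappa * t) kappa.
    by have := @is_deriveZ _ _ _ id kappa t 1 _ (is_derive_id _ _);
      rewrite /GRing.scale /= mulr1.
  have := is_deriveB d1 (is_deriveD d4 d5); rewrite /G /b.
  rewrite (_ : S / 2 * (2 * C * expR (2 * C * t)) = S * C * expR (2 * C * t)) //.
  by field.
have Gle : G (c i1) <= G 0.
  have /andP[c0 c1] := cT i1.
  apply: (@ler0_derive1_le_cc _ G 0 T) => //; rewrite ?in_itv/= ?lexx ?c0 ?c1 //.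
  - by move=> x; rewrite in_itv/= => /GD[].
  - move=> x; rewrite in_itv/= => xT; rewrite derive1E; have [_ ->] := GD x xT.
    rewrite subr_le0; apply: (le_trans (ler_norm _)); rewrite normrM.
    apply: (@le_trans _ _ `|de x i1|); first by rewrite ler_piMl.
    rewrite (_ : S * C * _ = C * (S * expR (2 * C * x))); last by ring.
    apply: bde => // j; apply: leS.
    by case/andP: xT => x0 x1; rewrite !ltW.
  - move=> x; apply: cvgB.
      apply: cvgM; first exact: cvg_cst.
      exact: ec.
    apply: continuous_subspaceT => {}x; rewrite /b; apply: cvgD.
      apply: cvgM; first exact: cvg_cst.
      exact: cexp.
    exact: clin.
have Sle : S <= 2 * kappa * T.
  have : `|e (c i1) i1| <= b (c i1).
    move: Gle; rewrite /G e0 mulr0 /b mulr0 expR0 mulr0 addr0 /s -normrEsg lerBlDr.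
    move=> /le_trans; apply.
    by rewrite sub0r mulr1 gerDr oppr_le0 divr_ge0.
  have /andP[c0 c1] := cT i1.
  rewrite /b; set E := expR (2 * C * c i1).
  have E1 : 1 <= E by rewrite /E -expR0 ler_expR !mulr_ge0// ltW.
  have E0 : 0 < E by lra.
  have SE : `|e (c i1) i1| = S * E.
    by rewrite /S /g mulNr expRN -/E divfK // gt_eqF.
  rewrite SE => H.
  have {}H : S / 2 * E <= kappa * c i1.
    by lra.
  have SE2 : S / 2 * 1 <= S / 2 * E by rewrite ler_wpM2l // divr_ge0.
  have kc : kappa * c i1 <= kappa * T by rewrite ler_wpM2l.
  have := le_trans SE2 (le_trans H kc).
  by rewrite mulr1 ler_pdivrMr // mulrC mulrA.
apply: le_trans (leS _ _ t0T) _.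
apply: ler_pM => //; rewrite ?expR_ge0 //.
rewrite ler_expR ler_wpM2l // ?mulr_ge0 //; last by case/andP: t0T.
exact: ltW.
Qed.

(** * A Chernoff bound for finitely many Boolean variables *)

(** Inverting exp (- x) >= 1 - x gives exp x <= 1 / (1 - x). *)
Lemma expR_le_quadratic (R : realType) (x : R) :
  x <= 2^-1 -> expR x <= 1 + x + 2 * x ^+ 2.
Proof.
move=> x12; have x1 : 0 < 1 - x by lra.
have : 1 - x <= expR (- x) by exact: expR_ge1Dx.
rewrite expRN => xe; have : expR x <= (1 - x)^-1.
  by rewrite -[expR x]invrK lef_pV2 // posrE // invr_gt0 expR_gt0.
move=> /le_trans; apply; rewrite -[_^-1]mul1r ler_pdivrMr //.
have : 0 <= x ^+ 2 * (1 - 2 * x) by rewrite mulr_ge0 ?sqr_ge0 //; lra.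
nra.
Qed.

(** The linear terms of the two exponentials cancel in the mean, so that only the
variance p (1 - p) <= p remains.  Keeping the factor p in the exponent is what
later yields n alpha, and not n alpha^2, in the tail. *)
Lemma bernoulli_mgf_le (R : realType) (p c l : R) :
  0 <= p <= 1 -> `|c| <= 1 -> 0 <= l <= 2^-1 ->
  \sum_(b : bool) expR (l * ((b%:R - p) * c)) * bernoulli_pmf p b
    <= expR (2 * l ^+ 2 * p).
Proof.
move=> /andP[p0 p1] c1 /andP[l0 l1].
rewrite big_bool /bernoulli_pmf /=.
have small (d : R) : `|d| <= 1 ->
    expR (l * (d * c)) <= 1 + l * (d * c) + 2 * (l * (d * c)) ^+ 2.
  move=> d1; apply: expR_le_quadratic.
  apply: le_trans (ler_norm _) _; rewrite !normrM (ger0_norm l0).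
  have dc : `|d| * `|c| <= 1 by rewrite mulr_ile1.
  by rewrite -[leRHS]mulr1 ler_pM // mulr_ge0.
have e1 := small (1 - p); have e0 := small (0 - p).
have H1 : `|1 - p| <= 1 by rewrite ler_norml; apply/andP; split; lra.
have H0 : `|0 - p| <= 1 by rewrite ler_norml; apply/andP; split; lra.
apply: le_trans (_ : _ <= (1 + l * ((1 - p) * c) + 2 * (l * ((1 - p) * c)) ^+ 2) * p +
  (1 + l * ((0 - p) * c) + 2 * (l * ((0 - p) * c)) ^+ 2) * (1 - p)) _.
  by apply: lerD; rewrite ler_wpM2r ?e1 ?e0 ?subr_ge0.
apply: le_trans (expR_ge1Dx _).
have c2 : c ^+ 2 <= 1 by rewrite -(expr1n _ 2) -real_normK ?num_real// lerXn2r ?nnegrE.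
have -> : (1 + l * ((1 - p) * c) + 2 * (l * ((1 - p) * c)) ^+ 2) * p +
  (1 + l * ((0 - p) * c) + 2 * (l * ((0 - p) * c)) ^+ 2) * (1 - p) =
  1 + 2 * l ^+ 2 * (p * (c ^+ 2 * (1 - p))) by ring.
rewrite lerD2l ler_wpM2l //; first by rewrite mulr_ge0 ?sqr_ge0.
rewrite -[leRHS]mulr1 ler_wpM2l // -[leRHS]mulr1.
by rewrite ler_pM ?sqr_ge0 ?subr_ge0 //; lra.
Qed.

(** The exponential moment method on the product law of independent Bernoulli
variables, written as a finite sum over their joint values. *)
Lemma bernoulli_chernoff (R : realType) (J : finType) (p c : J -> R) (m s : R) :
  (forall j, 0 <= p j <= 1) -> (forall j, `|c j| <= 1) ->
  \sum_j p j <= m -> 0 <= s <= 2 ->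
  \sum_(b : {ffun J -> bool} | s * m <= \sum_j ((b j)%:R - p j) * c j)
     \prod_j bernoulli_pmf (p j) (b j) <= expR (- (m * s ^+ 2 / 8)).
Proof.
move=> p01 c1 pm /andP[s0 s2].
(* The minimiser of - l s m + 2 l^2 m. *)
pose l := s / 4.
have l01 : 0 <= l <= 2^-1 by rewrite /l; apply/andP; split; lra.
have pmf0 (b : {ffun J -> bool}) : 0 <= \prod_j bernoulli_pmf (p j) (b j).
  by apply: prodr_ge0 => j _; exact: bernoulli_pmf_ge0.
apply: (@le_trans _ _ (\sum_(b : {ffun J -> bool}) expR (- (l * (s * m))) *
    \prod_j (expR (l * (((b j)%:R - p j) * c j)) * bernoulli_pmf (p j) (b j)))).
  rewrite [leRHS](bigID (fun b : {ffun J -> bool} =>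
    s * m <= \sum_j ((b j)%:R - p j) * c j)) /=.
  rewrite -[leLHS]addr0; apply: lerD; last first.
    apply: sumr_ge0 => b _; rewrite mulr_ge0 ?expR_ge0 //.
    by apply: prodr_ge0 => j _; rewrite mulr_ge0 ?expR_ge0 ?bernoulli_pmf_ge0.
  apply: ler_sum => b sb; rewrite big_split /= [leRHS]mulrA -[leLHS]mul1r.
  rewrite ler_wpM2r // -expR_sum -mulr_sumr -expRD -[leLHS]expR0 ler_expR.
  by rewrite [leRHS]addrC -mulrBr mulr_ge0 ?subr_ge0 //; case/andP: l01.
rewrite -mulr_sumr.
rewrite -(bigA_distr_bigA (fun j (b : bool) =>
  expR (l * ((b%:R - p j) * c j)) * bernoulli_pmf (p j) b)).
apply: (@le_trans _ _ (expR (- (l * (s * m))) * \prod_j expR (2 * l ^+ 2 * p j))).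
  rewrite ler_wpM2l ?expR_ge0 //; apply: ler_prod => j _; apply/andP; split.
    by apply: sumr_ge0 => b _; rewrite mulr_ge0 ?expR_ge0 ?bernoulli_pmf_ge0.
  exact: bernoulli_mgf_le.
rewrite -expR_sum -mulr_sumr -expRD ler_expR.
have : 2 * l ^+ 2 * \sum_j p j <= 2 * l ^+ 2 * m.
  by rewrite ler_wpM2l // mulr_ge0 ?sqr_ge0.
rewrite /l; lra.
Qed.

Section finite_observables.
Context {d : measure_display} {Omega : measurableType d} {R : realType}.
Context (P : probability Omega R) (J : finType) (X : J -> {RV P >-> bool}).

(** An event that is determined by finitely many Boolean variables is a finite
union of cylinders, whatever complicated condition defines it. *)
Lemma measurable_of_bool_family (E : set Omega) :
  (forall w w', (forall j, X j w = X j w') -> E w -> E w') -> measurable E.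
Proof.
move=> XE; pose Q : set {ffun J -> bool} := [set [ffun j => X j w] | w in E].
have -> : E = \bigcup_(b in Q) \bigcap_(j in [set: J]) (X j @^-1` [set b j]).
  apply/seteqP; split => [w Ew|w [_ [w' Ew' <-]] /= Xw].
    exists [ffun j => X j w]; first by exists w.
    by move=> j _ /=; rewrite ffunE.
  by apply: XE Ew' => j; rewrite Xw // ffunE.
apply: fin_bigcup_measurable; first exact: finite_finset.
move=> b _; apply: fin_bigcap_measurable; first exact: finite_finset.
by move=> j _; rewrite -[X in measurable X]setTI; exact: measurable_funPT.
Qed.

Lemma measure_bigsetU_le (I : Type) (r : seq I) (Q : pred I)
    (F : I -> set Omega) : (forall i, measurable (F i)) ->
  (P (\big[setU/set0]_(i <- r | Q i) F i) <= \sum_(i <- r | Q i) P (F i))%E.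
Proof.
move=> mF; elim: r => [|i r IH]; first by rewrite !big_nil measure0.
rewrite !big_cons; case: ifP => // _.
apply: le_trans (leeD2l _ IH); apply: measureU2 => //.
exact: bigsetU_measurable.
Qed.

Lemma probability_bool_family_le (p : J -> R) (Q : pred {ffun J -> bool}) :
  (forall b : {ffun J -> bool},
    P [set w | [ffun j => X j w] = b] =
    (\prod_j bernoulli_pmf (p j) (b j))%:E) ->
  (P [set w | Q [ffun j => X j w]] <=
   (\sum_(b | Q b) \prod_j bernoulli_pmf (p j) (b j))%:E)%E.
Proof.
move=> Pb; rewrite -sumEFin; under eq_bigr do rewrite -Pb.
have mX (B : set {ffun J -> bool}) : measurable [set w | B [ffun j => X j w]].
  apply: measurable_of_bool_family => w w' ww' /=.
  by under eq_ffun do rewrite ww'.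
apply: le_trans (measure_bigsetU_le _ _ _); last by move=> b; exact: (mX [set b]).
rewrite -bigcup_pred le_measure ?inE //.
- exact: (mX [set b | Q b]).
- apply: fin_bigcup_measurable => [|b _]; first exact: finite_finset.
  exact: (mX [set b]).
- by move=> w Qw; exists [ffun j => X j w].
Qed.

End finite_observables.

(** * Concentration of the rows of a random network *)

Lemma bernoulli_prob_set1 (R : realType) (p : R) (b : bool) :
  0 <= p <= 1 -> bernoulli_prob p [set b] = (bernoulli_pmf p b)%:E.
Proof. by move=> p01; rewrite /bernoulli_prob p01 fsbig_set1. Qed.

(** Independence is given for the pairs (i, j) with i <= j only.  Row i of the
matrix is made of such pairs, up to the symmetry, and no pair occurs twice, so
that its entries are independent. *)
Lemma network_row_law d (Omega : measurableType d) (R : realType)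
    (P : probability Omega R) (W : R * R -> R) (n : nat) (alpha : R)
    (A : 'I_n -> 'I_n -> {RV P >-> bool}) (i : 'I_n) :
  W_random_network W alpha A ->
  (forall j, 0 <= alpha * cell_average W i j <= 1) ->
  forall b : {ffun 'I_n -> bool},
    P [set w | [ffun j => A i j w] = b] =
    (\prod_j bernoulli_pmf (alpha * cell_average W i j) (b j))%:E.
Proof.
move=> [Asym Alaw Aindep] p01 b.
(* phi lists the pairs met by row i, and other recovers the column from a pair. *)
pose phi (j : 'I_n) : 'I_n * 'I_n := if (i <= j)%N then (i, j) else (j, i).
pose other (jk : 'I_n * 'I_n) := if jk.1 == i then jk.2 else jk.1.
have phiK : cancel phi other.
  move=> j; rewrite /phi /other; case: leqP => ij /=; rewrite ?eqxx //.
  by rewrite ifF //; apply/eqP => ji; rewrite ji ltnn in ij.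
have Aphi j w : A (phi j).1 (phi j).2 w = A i j w.
  by rewrite /phi; case: leqP.
have := Aindep [set phi j | j in [set: 'I_n]]%SET (fun jk => [set b (other jk)]).
rewrite big_imset /=; last by move=> j k _ _ /(can_inj phiK).
have sub : [set phi j | j in [set: 'I_n]]%SET \subset
    [set jk : 'I_n * 'I_n | (jk.1 <= jk.2)%N]%SET.
  apply/fintype.subsetP => _ /imsetP[j _ ->]; rewrite inE /phi.
  by case: (leqP i j) => /= [|/ltnW].
move=> /(_ sub (fun=> I)) H; rewrite -prodEFin.
transitivity (\prod_(j in [set: 'I_n]%SET)
   P ((fun w => A (phi j).1 (phi j).2 w) @^-1` [set b (other (phi j))]))%E.
  rewrite -H.
  congr (P _); apply/seteqP; split => w /=.
    move=> Ab jk /= /imsetP[j _ ->]; rewrite phiK Aphi.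
    by rewrite -Ab ffunE.
  move=> Ab; apply/ffunP => j; rewrite ffunE -Aphi -[in RHS](phiK j).
  by apply: Ab => /=; exact: imset_f.
apply: eq_big => [j|j _]; first by rewrite !inE.
rewrite phiK.
rewrite -bernoulli_prob_set1 // -Alaw /distribution /pushforward /=.
by congr (P _); apply/seteqP; split => w /=; rewrite Aphi.
Qed.

Lemma network_row_deviation d (Omega : measurableType d) (R : realType)
    (P : probability Omega R) (W : R * R -> R) (n : nat) (alpha : R)
    (A : 'I_n -> 'I_n -> {RV P >-> bool}) (i : 'I_n) (c : 'I_n -> R) (m s : R) :
  W_random_network W alpha A ->
  (forall j, 0 <= alpha * cell_average W i j <= 1) ->
  \sum_j alpha * cell_average W i j <= m ->
  (forall j, `|c j| <= 1) -> 0 <= s <= 2 ->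
  (P [set w | (s * m < `|\sum_j ((A i j w)%:R - alpha * cell_average W i j) * c j|)%R]
   <= (2 * expR (- (m * s ^+ 2 / 8)))%:E)%E.
Proof.
move=> AW p01 pm c1 s02.
pose S (e : 'I_n -> R) (b : {ffun 'I_n -> bool}) :=
  \sum_j ((b j)%:R - alpha * cell_average W i j) * e j.
have tail e : (forall j, `|e j| <= 1) ->
    (P [set w | (s * m <= S e [ffun j => A i j w])%R] <=
     (expR (- (m * s ^+ 2 / 8)))%:E)%E.
  move=> e1.
  have := @probability_bool_family_le _ _ _ P _ (A i) _
    (fun b => s * m <= S e b) (network_row_law AW p01).
  move=> /le_trans; apply; rewrite lee_fin.
  exact: bernoulli_chernoff.
have mS e : measurable [set w | (s * m <= S e [ffun j => A i j w])%R].
  apply: (@measurable_of_bool_family _ _ _ _ _ (A i)) => w w' ww' /=.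
  by under eq_ffun do rewrite ww'.
rewrite mulrDl mul1r EFinD.
apply: le_trans (leeD (tail c c1) (tail (fun j => - c j) _)); last first.
  by move=> j; rewrite normrN.
apply: (le_trans _ (measureU2 P (mS c) (mS (fun j => - c j)))).
have SE w : \sum_j ((A i j w)%:R - alpha * cell_average W i j) * c j =
    S c [ffun j => A i j w].
  by rewrite /S; apply: eq_bigr => j _; rewrite ffunE.
have SN b : S (fun j => - c j) b = - S c b.
  by rewrite /S -sumrN; apply: eq_bigr => j _; rewrite mulrN.
apply: le_measure; rewrite ?inE.
- apply: (@measurable_of_bool_family _ _ _ _ _ (A i)) => w w' ww' /=.
  by under eq_bigr do rewrite ww'.
- exact: measurableU.
move=> w /=; rewrite SE SN ltNge ler_norml negb_and -!ltNge ltrNr => /orP[] /ltW;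
  [by right|by left].
Qed.

Lemma network_deviation d (Omega : measurableType d) (R : realType)
    (P : probability Omega R) (W : R * R -> R) (n : nat) (alpha : R)
    (A : 'I_n -> 'I_n -> {RV P >-> bool}) (K : finType)
    (c : K -> 'I_n -> 'I_n -> R) (m s : R) :
  W_random_network W alpha A ->
  (forall i j : 'I_n, 0 <= alpha * cell_average W i j <= 1) ->
  (forall i : 'I_n, \sum_j alpha * cell_average W i j <= m) ->
  (forall k i j, `|c k i j| <= 1) -> 0 <= s <= 2 ->
  ((1 - #|K|%:R * n%:R * (2 * expR (- (m * s ^+ 2 / 8))))%:E <=
   P [set w | forall k i,
       (`|\sum_j ((A i j w)%:R - alpha * cell_average W i j) * c k i j|
          <= s * m)%R])%E.
Proof.
move=> AW p01 pm c1 s02; set E := [set w | _]%classic.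
pose F (ki : K * 'I_n) := [set w : Omega |
  s * m < `|\sum_j ((A ki.2 j w)%:R - alpha * cell_average W ki.2 j) *
     c ki.1 ki.2 j|].
have mF ki : measurable (F ki).
  apply: (@measurable_of_bool_family _ _ _ _ _ (A ki.2)) => w w' ww'.
  by rewrite /F /=; under eq_bigr do rewrite ww'.
have -> : E = ~` (\big[setU/set0]_(ki : K * 'I_n) F ki).
  rewrite -bigcup_pred; apply/seteqP; split => w /=.
    by move=> Ew [ki _]; rewrite /F /= ltNge Ew.
  move=> nF k i; rewrite leNgt; apply/negP => kiF; apply: nF.
  by exists (k, i).
rewrite probability_setC; last exact: bigsetU_measurable.
rewrite EFinB leeB // ?lee_fin //.
apply: le_trans (measure_bigsetU_le _ _ _ mF) _.
apply: (@le_trans _ _ (\sum_(ki : K * 'I_n) (2 * expR (- (m * s ^+ 2 / 8)))%:E)%E).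
  apply: lee_sum => ki _; exact: network_row_deviation.
rewrite sumEFin sumr_const lee_fin card_prod card_ord -natrM.
by rewrite [leRHS]mulr_natl.
Qed.

(** * Uniform continuity, cells and Riemann sums *)

Lemma compact_uniformly_continuous (R : realType) (X : pseudoMetricType R)
    (K : set X) (g : X -> R) :
  compact K -> {within K, continuous g} ->
  forall e : R, 0 < e -> exists2 r : R, 0 < r &
    forall p q, K p -> K q -> ball p r q -> `|g p - g q| < e.
Proof.
move=> cK cg e e0.
have cov : near_covering_within K by apply/near_covering_withinP/compact_near_coveringP.
have := cov _ (0^'+ : set_system R)
  (fun r p => forall q, K q -> ball p r q -> `|g p - g q| < e) _.
case.
  move=> x Kx; move/subspace_continuousP : cg => /(_ x Kx).
  move=> /cvgrPdist_lt /(_ (e / 2)); rewrite divr_gt0 // => /(_ isT).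
  rewrite near_withinE => /nbhs_ballP[r /= r0 xr].
  have r20 : 0 < r / 2 by rewrite divr_gt0.
  exists (ball x (r / 2), [set r' | r' < r / 2]).
    split => /=; first exact: nbhsx_ballx.
    exact: nbhs_right_lt.
  move=> [p r'] /= [xp r'r] Kp q Kq pq.
  have xq : ball x r q.
    rewrite [r]splitr; apply: ball_triangle xp _.
    exact: le_ball (ltW r'r) _ pq.
  have xp' : ball x r p by apply: le_ball xp; rewrite ler_pdivrMr // ler_peMr ?ltW //; lra.
  have := xr _ xp' Kp; have := xr _ xq Kq.
  rewrite -[g p - g q](subrKA (g x)) => gq gp.
  apply: le_lt_trans (ler_normD _ _) _.
  by rewrite [e]splitr ltrD // distrC.
move=> r0 /= r0gt H.
exists (r0 / 2); first by rewrite divr_gt0.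
move=> p q Kp Kq pq; apply: (H (r0 / 2)) => //=.
- rewrite /ball_ /= sub0r normrN gtr0_norm ?divr_gt0 // ltr_pdivrMr // ltr_pMr //; lra.
- by rewrite divr_gt0.
Qed.

Section cells.
Context {R : realType} (n : nat).
Hypothesis n_gt0 : (0 < n)%N.

Lemma cell_itv (i : 'I_n) (x : R) :
  cell i x <-> i%:R / n%:R <= x < i.+1%:R / n%:R.
Proof. by rewrite /cell /= in_itv. Qed.

Lemma cell_sub_unit (i : 'I_n) : (cell i : set R) `<=` unit_itv.
Proof.
move=> x /cell_itv/andP[x0 x1]; rewrite /unit_itv /= in_itv /=.
have n0 : 0 < n%:R :> R by rewrite ltr0n.
rewrite (le_trans _ x0) ?divr_ge0 //= (le_trans (ltW x1)) //.
by rewrite ler_pdivrMr // mul1r ler_nat.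
Qed.

Lemma mem_cell (x : R) : 0 <= x < 1 -> exists i : 'I_n, cell i x.
Proof.
move=> /andP[x0 x1]; have n0 : 0 < n%:R :> R by rewrite ltr0n.
have /andP[k0 k1] := @truncn_itv R (x * n%:R) (mulr_ge0 x0 (ltW n0)).
have kn : (Num.truncn (x * n%:R) < n)%N.
  rewrite -(ltr_nat R); apply: le_lt_trans k0 _.
  by rewrite -[ltRHS]mul1r ltr_pM2r.
by exists (Ordinal kn); apply/cell_itv; rewrite ler_pdivrMr // ltr_pdivlMr // k0 k1.
Qed.

Lemma interpolant_cell (u : 'I_n -> R) (i : 'I_n) (x : R) :
  cell i x -> interpolant u x = u i.
Proof.
move=> ix; rewrite /interpolant (bigD1 i) //= indicE mem_set // mulr1.
rewrite big1 ?addr0 // => j ji; rewrite indicE memNset ?mulr0 // => jx.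
move/cell_itv : ix => /andP[i0 i1]; move/cell_itv : jx => /andP[j0 j1].
have n0 : 0 < n%:R :> R by rewrite ltr0n.
have := le_lt_trans i0 j1; have := le_lt_trans j0 i1.
rewrite !ltr_pM2r ?invr_gt0 // !ltr_nat !ltnS => ji' ij'.
by move/negP : ji; apply; rewrite -val_eqE eqn_leq ji' ij'.
Qed.

Lemma cell_dist (i : 'I_n) (x y : R) : cell i x -> cell i y -> `|x - y| < n%:R^-1.
Proof.
move=> /cell_itv/andP[x0 x1] /cell_itv/andP[y0 y1].
have e : i.+1%:R / n%:R = i%:R / n%:R + n%:R^-1 :> R.
  by rewrite -natr1 mulrDl mul1r.
rewrite e in x1 y1; rewrite ltr_norml; apply/andP; split; lra.
Qed.

Lemma cell_left (i : 'I_n) : (cell i : set R) (i%:R / n%:R).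
Proof.
apply/cell_itv; rewrite lexx /= ltr_pM2r ?ltr_nat //.
by rewrite invr_gt0 ltr0n.
Qed.

Lemma measurable_cell (i : 'I_n) : measurable (cell i : set R).
Proof. exact: measurable_itv. Qed.

Lemma lebesgue_measure_cell (i : 'I_n) :
  lebesgue_measure (cell i : set R) = (n%:R^-1)%:E.
Proof.
rewrite /cell lebesgue_measure_itv /= lte_fin.
have n0 : 0 < n%:R :> R by rewrite ltr0n.
rewrite ltr_pM2r ?invr_gt0 // ltr_nat ltnSn -EFinB.
by rewrite -mulrBl -natr1 addrAC subrr add0r mul1r.
Qed.

(** Monotonicity is read off the definition: the integral of a nonnegative
function is the supremum of the integrals of the simple functions below it, and
a larger function has more of them. *)
Lemma cell_average_bounds (W : R * R -> R) (i j : 'I_n) (a b : R) :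
  0 <= a -> (forall x y, cell i x -> cell j y -> a <= W (x, y) <= b) ->
  a <= cell_average W i j <= b.
Proof.
move=> a0 Wab; pose mu := (@lebesgue_measure R \x @lebesgue_measure R)%E.
have n0 : 0 < n%:R :> R by rewrite ltr0n.
pose S := cell i `*` cell j : set (R * R).
have mS : measurable S by apply: measurableX; exact: measurable_cell.
have muS : mu S = (n%:R^-1 * n%:R^-1)%:E.
  rewrite /mu /S product_measure1E; try exact: measurable_cell.
  by rewrite EFinM; congr (_ * _)%E; exact: lebesgue_measure_cell.
have le_int (g h : R * R -> R) : (forall p, S p -> 0 <= g p <= h p) ->
    (\int[mu]_(p in S) (g p)%:E <= \int[mu]_(p in S) (h p)%:E)%E.
  move=> gh; rewrite !ge0_integralE => [|p /gh/andP[]|p /gh/andP[]].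
  - apply: le_ereal_sup => _ [f /= fg <-]; exists f => // p.
    apply: le_trans (fg p) _; rewrite /patch; case: ifPn => // /set_mem Sp.
    by rewrite lee_fin; case/andP: (gh p Sp).
  - by move=> g0 gh'; rewrite lee_fin (le_trans g0).
  - by move=> g0 _; rewrite lee_fin.
have int_cst (r : R) : (\int[mu]_(p in S) (cst r%:E) p = (r * (n%:R^-1 * n%:R^-1))%:E)%E.
  by rewrite EFinM -muS; exact: integral_cst.
have lo : ((a * (n%:R^-1 * n%:R^-1))%:E <= \int[mu]_(p in S) (W p)%:E)%E.
  rewrite -int_cst; apply: le_int => -[x y] [/= ix jy].
  by rewrite a0; case/andP: (Wab x y ix jy).
have hi : (\int[mu]_(p in S) (W p)%:E <= (b * (n%:R^-1 * n%:R^-1))%:E)%E.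
  rewrite -int_cst; apply: le_int => -[x y] [/= ix jy].
  by case/andP: (Wab x y ix jy) => aW ->; rewrite (le_trans a0).
rewrite /cell_average /Rintegral -/mu -/S.
move: lo hi; case: (integral _ _ _) => [v| |] //=; rewrite !lee_fin.
rewrite -!invfM -expr2 => lo hi.
have N0 : 0 < n%:R ^+ 2 :> R by rewrite exprn_gt0.
by rewrite ![_ * v]mulrC -ler_pdivrMr // lo -ler_pdivlMr.
Qed.

Lemma Rintegral_cell (g : R -> R) (i : 'I_n) (c w : R) :
  lebesgue_measure.-integrable (cell i) (EFin \o g) ->
  (forall y, cell i y -> `|g y - c| <= w) ->
  `|\int[lebesgue_measure]_(y in cell i) g y - n%:R^-1 * c| <= n%:R^-1 * w.
Proof.
move=> ig gc.
have icst (r : R) : lebesgue_measure.-integrable (cell i) (EFin \o cst r).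
  apply: measurable_bounded_integrable; last 2 first.
  - exact: measurable_cst.
  - exists `|r|; split => // M rM y _ /=; exact: ltW.
  - exact: measurable_cell.
  - by have := ltry (n%:R^-1 : R); rewrite -(lebesgue_measure_cell i).
have Icst (r : R) : \int[lebesgue_measure]_(y in cell i) r = n%:R^-1 * r.
  have -> : n%:R^-1 = fine (lebesgue_measure (cell i : set R)).
    by rewrite lebesgue_measure_cell.
  by rewrite mulrC; apply: Rintegral_cst; exact: measurable_cell.
rewrite ler_distl -mulrBr -mulrDr -!Icst; apply/andP; split.
  apply: le_Rintegral; [exact: measurable_cell|exact: icst|exact: ig|].
  by move=> y /gc; rewrite ler_distl => /andP[].
apply: le_Rintegral; [exact: measurable_cell|exact: ig|exact: icst|].
by move=> y /gc; rewrite ler_distl => /andP[].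
Qed.

(** Consecutive differences of the integral over [0, k / n] are the integrals over
the cells, up to an endpoint, and they telescope. *)
Lemma riemann_sum_error (g : R -> R) (c : 'I_n -> R) (w : R) :
  {within unit_itv, continuous g} ->
  (forall j y, cell j y -> `|g y - c j| <= w) ->
  `|n%:R^-1 * \sum_j c j - \int[lebesgue_measure]_(y in unit_itv) g y| <= w.
Proof.
move=> cg gc; pose F k := \int[lebesgue_measure]_(y in `[0, k%:R / n%:R]) g y.
have n0 : 0 < n%:R :> R by rewrite ltr0n.
have ig : lebesgue_measure.-integrable unit_itv (EFin \o g).
  by apply: continuous_compact_integrable => //; exact: segment_compact.
have F0 : F 0 = 0 by rewrite /F mul0r set_itv1 Rintegral_set1.
have Fn : F n = \int[lebesgue_measure]_(y in unit_itv) g y.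
  by rewrite /F divff // gt_eqF.
have FS (j : 'I_n) : F j.+1 - F j = \int[lebesgue_measure]_(y in cell j) g y.
  have jn : (j.+1%:R / n%:R <= 1 :> R) by rewrite ler_pdivrMr // mul1r ler_nat.
  have ltj : j%:R / n%:R < j.+1%:R / n%:R :> R.
    by rewrite ltr_pM2r ?invr_gt0 // ltr_nat.
  have isub (A : set R) : measurable A -> A `<=` unit_itv ->
      lebesgue_measure.-integrable A (EFin \o g).
    by move=> mA Au; apply: integrableS ig => //; exact: measurable_unit_itv.
  have j0 : 0 <= j%:R / n%:R :> R by rewrite divr_ge0.
  rewrite /F Rintegral_itvB; last 3 first.
  - apply: isub => // y; rewrite /unit_itv /= !in_itv /= => /andP[-> /=].
    by move=> y1; exact: le_trans y1 jn.
  - by rewrite bnd_simp.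
  - by rewrite bnd_simp ltW.
  rewrite Rintegral_itv_obnd_cbnd; last first.
    apply: isub => // y; rewrite /unit_itv /= !in_itv /= => /andP[y0 y1].
    by rewrite (le_trans j0 (ltW y0)) (le_trans y1).
  by rewrite -Rintegral_itv_bndo_bndc //; apply: isub;
    [exact: measurable_cell|exact: cell_sub_unit].
have -> : \int[lebesgue_measure]_(y in unit_itv) g y =
    \sum_(j < n) \int[lebesgue_measure]_(y in cell j) g y.
  rewrite -Fn -[LHS]subr0 -[X in _ - X]F0 -(telescope_sumr F) // big_mkord.
  by apply: eq_bigr => j _; exact: FS.
rewrite distrC mulr_sumr -sumrB; apply: le_trans (ler_norm_sum _ _ _) _.
apply: (@le_trans _ _ (\sum_(j < n) n%:R^-1 * w)).
  apply: ler_sum => j _; apply: Rintegral_cell; last exact: gc.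
  apply: integrableS ig; [exact: measurable_unit_itv|exact: measurable_cell|].
  exact: cell_sub_unit.
by rewrite sumr_const card_ord -[leLHS]mulr_natl mulVKf // gt_eqF.
Qed.

End cells.

(** * Comparison of the sampled and the continuum system *)

Lemma lipschitz_constant (R : realType) (f : R -> R) : lipschitz f ->
  \forall L \near +oo, forall x y, `|f x - f y| <= L * `|x - y|.
Proof.
by move=> lf; near=> L => x y; have /(_ (x, y) (conj I I)) : L.-lipschitz f by near: L.
Unshelve. all: by end_near.
Qed.

Lemma half_line_regular (R : realType) (u du : R -> R) :
  (forall t : R, half_line t -> has_derivative_in half_line u t (du t)) ->
  (forall T : R, {within `[0, T], continuous u}) /\
  (forall t : R, 0 < t -> is_derive t 1 u (du t)).
Proof.
move=> udu; split=> [T|t t0].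
  apply/subspace_continuousP => t /=; rewrite in_itv /= => /andP[t0 _].
  have /udu/has_derivative_in_continuous : half_line t.
    by rewrite /half_line /= in_itv /= andbT.
  apply: cvg_trans; apply: cvg_app; apply: within_subset.
  by move=> s /=; rewrite /half_line /= !in_itv /= => /andP[->].
have th : half_line t by rewrite /half_line /= in_itv /= andbT ltW.
apply: has_derivative_in_is_derive (udu t th).
have t_nbhs : nbhs t (`]0, +oo[%classic : set R).
  by apply: open_nbhs_nbhs; split; [exact: interval_open|rewrite /= in_itv /= t0].
apply: filterS t_nbhs => s /=.
by rewrite /half_line /= !in_itv /= !andbT => /ltW.
Qed.

Section coupling.
Context {R : realType} (n : nat) (alpha : R) (L : R) (D : R -> R).
Hypotheses (n_gt0 : (0 < n)%N) (alpha_gt0 : 0 < alpha) (L_gt0 : 0 < L).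
Hypothesis D_lip : forall x y, `|D x - D y| <= L * `|x - y|.

(** The degree bound q n alpha turns the normalised random coupling into a map
that is Lipschitz for the maximum norm. *)
Lemma coupling_lipschitz (a : 'I_n -> 'I_n -> bool) (u v : 'I_n -> R)
    (i : 'I_n) (q m : R) :
  \sum_j (a i j)%:R <= q * (n%:R * alpha) ->
  (forall j, `|u j - v j| <= m) ->
  `|(n%:R * alpha)^-1 * \sum_j (a i j)%:R * (D (u j - u i) - D (v j - v i))|
    <= 2 * q * L * m.
Proof.
move=> deg uv; have na0 : 0 < n%:R * alpha by rewrite mulr_gt0 ?ltr0n.
have m0 : 0 <= m by apply: le_trans (uv i).
rewrite normrM gtr0_norm ?invr_gt0 // mulrC ler_pdivrMr //.
apply: le_trans (ler_norm_sum _ _ _) _.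
apply: (@le_trans _ _ (\sum_j (a i j)%:R * (2 * L * m))).
  apply: ler_sum => j _; rewrite normrM normr_nat ler_wpM2l //.
  apply: le_trans (D_lip _ _) _.
  rewrite [2 * L]mulrC -mulrA; apply: ler_wpM2l; first exact: ltW.
  have -> : u j - u i - (v j - v i) = (u j - v j) - (u i - v i) by ring.
  by apply: le_trans (ler_normB _ _) _; rewrite mulrDl !mul1r lerD.
rewrite -mulr_suml (_ : 2 * q * L * m * _ = q * (n%:R * alpha) * (2 * L * m)); last by ring.
by rewrite ler_wpM2r // !mulr_ge0 // ltW.
Qed.

Context (f : R -> R) (eta : R -> R).
Hypothesis f_lip : forall x y, `|f x - f y| <= L * `|x - y|.

(** Gronwall with kappa = 0.  Here the trivial degree bound n suffices, because
the Lipschitz constant may depend on n. *)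
Lemma SDS_solution_unique (a : 'I_n -> 'I_n -> bool) (u v : R -> 'I_n -> R) :
  SDS_solution alpha a f D eta u -> SDS_solution alpha a f D eta v ->
  forall t : R, 0 <= t -> u t = v t.
Proof.
move=> [u0 du] [v0 dv] T T0; apply/funext => i.
have {du} du j := half_line_regular (fun t => du t j).
have {dv} dv j := half_line_regular (fun t => dv t j).
pose C := L + 2 * alpha^-1 * L.
have C0 : 0 < C by rewrite addr_gt0 // !mulr_gt0 ?invr_gt0.
apply/eqP; rewrite -subr_eq0 -normr_le0.
have := @gronwall_sup R 'I_n T C 0 (fun t j => u t j - v t j)
  (fun (t : R) j => (f (u t j) + (n%:R * alpha)^-1 *
      \sum_(k < n) (a j k)%:R * D (u t k - u t j)) -
   (f (v t j) + (n%:R * alpha)^-1 * \sum_(k < n) (a j k)%:R * D (v t k - v t j)))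
  C0 (lexx 0) _ _ _ _ T i.
rewrite mulr0 !mul0r; apply; last by rewrite T0 lexx.
- move=> j; have [cu _] := du j; have [cv _] := dv j.
  by move=> t; apply: cvgB; [exact: cu|exact: cv].
- move=> t j /andP[t0 _]; have [_ /(_ t t0) d1] := du j; have [_ /(_ t t0) d2] := dv j.
  exact: is_deriveB.
- by move=> j; rewrite u0 v0 subrr.
move=> t j m _ uv; rewrite addr0 opprD addrACA -mulrBr -sumrB.
under eq_bigr do rewrite -mulrBr.
apply: le_trans (ler_normD _ _) _; rewrite mulrDl; apply: lerD.
  by apply: le_trans (f_lip _ _) _; rewrite ler_wpM2l // ltW.
apply: coupling_lipschitz => //.
have -> : alpha^-1 * (n%:R * alpha) = n%:R by rewrite mulrCA mulVf ?gt_eqF ?mulr1.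
rewrite -[leRHS](mulr1 n%:R) mulr_natl -[X in _ *+ X]card_ord -sumr_const.
by apply: ler_sum => k _; case: (a j k).
Qed.

End coupling.

Lemma within_continuous_slice (R : realType) (S B : set R) (g : R * R -> R) (a : R) :
  S a -> {within S `*` B, continuous g} ->
  {within B, continuous (fun y => g (a, y))}.
Proof.
move=> Sa /subspace_continuousP cg; apply/subspace_continuousP => y By.
apply: cvg_trans (cg (a, y) (conj Sa By)) => V /= [[U1 U2] /= [U1a U2y] UV].
change (\forall z \near y, B z -> V (g (a, z))).
apply: filterS U2y => z U2z Bz.
by apply: (UV (a, z)) => //=; split => //; exact: nbhs_singleton U1a.
Qed.

Lemma lipschitz_continuous (R : realType) (L : R) (D : R -> R) :
  (forall x y, `|D x - D y| <= L * `|x - y|) -> continuous D.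
Proof.
move=> D_lip x; apply/cvgrPdist_le => e e0.
have L1 : 0 < `|L| + 1 by rewrite ltr_wpDl.
near=> y; apply: le_trans (D_lip _ _) _.
apply: (@le_trans _ _ ((`|L| + 1) * `|x - y|)).
  by rewrite ler_wpM2r // (le_trans (ler_norm L)) // lerDl.
rewrite mulrC -ler_pdivlMr //; near: y.
by apply: cvgr_dist_le => //; rewrite divr_gt0.
Unshelve. all: by end_near.
Qed.

Section consistency.
Context {R : realType} (n : nat) (alpha : R) (L : R) (D : R -> R).
Hypotheses (n_gt0 : (0 < n)%N) (alpha_gt0 : 0 < alpha) (L_gt0 : 0 < L).
Hypothesis D_lip : forall x y, `|D x - D y| <= L * `|x - y|.
Hypothesis D_le1 : forall x, `|D x| <= 1.
Context (W : R * R -> R).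
Hypothesis W_continuous : {within unit_itv `*` unit_itv, continuous W}.
Hypothesis W_range : forall x y, unit_itv x -> unit_itv y -> unit_itv (W (x, y)).

Let node (i : 'I_n) : R := i%:R / n%:R.

Lemma node_unit (i : 'I_n) : unit_itv (node i).
Proof. by apply: (@cell_sub_unit _ _ n_gt0 i); exact: cell_left. Qed.

Lemma cell_average_unit (i j : 'I_n) : 0 <= cell_average W i j <= 1.
Proof.
apply: cell_average_bounds => // x y ix jy.
have := W_range (cell_sub_unit n_gt0 ix) (cell_sub_unit n_gt0 jy).
by rewrite /unit_itv /= in_itv.
Qed.

Lemma cell_average_dist (omega r : R) (i j : 'I_n) (y : R) :
  n%:R^-1 < r ->
  (forall p q, (unit_itv `*` unit_itv) p -> (unit_itv `*` unit_itv) q ->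
     ball p r q -> `|W p - W q| < omega) ->
  cell j y -> `|W (node i, y) - cell_average W i j| <= omega.
Proof.
move=> nr Wu jy.
have ui := node_unit i; have uy := cell_sub_unit n_gt0 jy.
have : 0 <= W (node i, y) by have := W_range ui uy; rewrite /unit_itv /= in_itv => /andP[].
set v := W (node i, y) => v0.
have : Num.max 0 (v - omega) <= cell_average W i j <= v + omega.
  apply: cell_average_bounds => //; first by rewrite le_max lexx.
  move=> x z ix jz; have ux := cell_sub_unit n_gt0 ix; have uz := cell_sub_unit n_gt0 jz.
  have : `|v - W (x, z)| < omega.
    apply: Wu => //; split => /=; rewrite /ball /=; apply: lt_trans nr;
    by [apply: cell_dist ix => //; exact: cell_left|exact: cell_dist jz].
  have := W_range ux uz; rewrite /unit_itv /= in_itv /= ge_max => /andP[-> _] /=.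
  by rewrite ltr_norml => /andP[? ?]; apply/andP; split; lra.
rewrite ge_max => /andP[/andP[_ ?] ?].
by rewrite ler_norml; apply/andP; split; lra.
Qed.

(** Here z is the continuum solution at the current time and z' at a nearby time
of the grid.  The error splits into three parts: the change from z to z' in the
random sum, the random fluctuation at the time of z', and the Riemann sum error
of the averaged coupling; they are bounded by 4 L omega, omega and
(2 L + 1) omega. *)
Lemma vector_field_consistency (a : 'I_n -> 'I_n -> bool) (z z' : R -> R)
    (omega r : R) (i : 'I_n) :
  n%:R^-1 < r -> 
  (forall p q, (unit_itv `*` unit_itv) p -> (unit_itv `*` unit_itv) q ->
     ball p r q -> `|W p - W q| < omega) ->
  {within unit_itv, continuous z} ->
  (forall x y, unit_itv x -> unit_itv y -> `|x - y| < r -> `|z x - z' y| < omega) ->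
  \sum_j (a i j)%:R <= 2 * (n%:R * alpha) ->
  `|\sum_j ((a i j)%:R - alpha * cell_average W i j) * D (z' (node j) - z' (node i))|
     <= omega * (n%:R * alpha) ->
  `|(n%:R * alpha)^-1 * \sum_j (a i j)%:R * D (z (node j) - z (node i)) -
    \int[lebesgue_measure]_(y in unit_itv) (W (node i, y) * D (z y - z (node i)))|
   <= (6 * L + 2) * omega.
Proof.
move=> nr Wu cz zz' deg dev.
have na0 : 0 < n%:R * alpha by rewrite mulr_gt0 ?ltr0n.
have r0 : 0 < r by apply: lt_trans nr; rewrite invr_gt0 ltr0n.
have znode j : `|z (node j) - z' (node j)| <= omega.
  by apply/ltW/zz'; rewrite ?subrr ?normr0 //; exact: node_unit.
set I0 := \int[_]_(_ in _) _.
pose Dz' j := D (z' (node j) - z' (node i)).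
have e1 : `|(n%:R * alpha)^-1 *
    \sum_j (a i j)%:R * (D (z (node j) - z (node i)) - Dz' j)| <= 4 * L * omega.
  have := coupling_lipschitz n_gt0 alpha_gt0 L_gt0 D_lip deg znode.
  by rewrite -[2 * 2]natrM.
have e2 : `|(n%:R * alpha)^-1 *
    \sum_j ((a i j)%:R - alpha * cell_average W i j) * Dz' j| <= omega.
  by rewrite normrM gtr0_norm ?invr_gt0 // mulrC ler_pdivrMr.
have e3 : `|n%:R^-1 * \sum_j cell_average W i j * Dz' j - I0| <= omega + 2 * L * omega.
  apply: riemann_sum_error => //.
    move=> y; apply: cvgM.
      exact: (within_continuous_slice (node_unit i) W_continuous).
    have cD := lipschitz_continuous D_lip.
    apply: continuous_comp; last exact: cD.
    by apply: cvgB; [exact: cz|exact: cvg_cst].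
  move=> j y jy; have uy := cell_sub_unit n_gt0 jy.
  have -> : W (node i, y) * D (z y - z (node i)) - cell_average W i j * Dz' j =
    (W (node i, y) - cell_average W i j) * D (z y - z (node i)) +
    cell_average W i j * (D (z y - z (node i)) - Dz' j) by ring.
  apply: le_trans (ler_normD _ _) _.
  rewrite (normrM (W _ - _)) (normrM (cell_average W i j)); apply: lerD.
    rewrite -[leRHS]mulr1; apply: ler_pM => //.
    exact: cell_average_dist nr Wu jy.
  have /andP[Wa0 Wa1] := cell_average_unit i j.
  rewrite -[leRHS]mul1r ger0_norm //; apply: ler_pM => //.
  rewrite /Dz'; apply: le_trans (D_lip _ _) _.
  rewrite [2 * L]mulrC -mulrA; apply: ler_wpM2l; first exact: ltW.
  have -> : z y - z (node i) - (z' (node j) - z' (node i)) =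
    (z y - z' (node j)) - (z (node i) - z' (node i)) by ring.
  apply: le_trans (ler_normB _ _) _; rewrite mulrDl !mul1r lerD //.
  apply/ltW/zz' => //; first exact: node_unit.
  by apply: lt_trans nr; apply: cell_dist jy _ => //; exact: cell_left.
have -> : (n%:R * alpha)^-1 * \sum_j (a i j)%:R * D (z (node j) - z (node i)) - I0 =
  (n%:R * alpha)^-1 * \sum_j (a i j)%:R * (D (z (node j) - z (node i)) - Dz' j) +
  ((n%:R * alpha)^-1 * \sum_j ((a i j)%:R - alpha * cell_average W i j) * Dz' j +
   (n%:R^-1 * \sum_j cell_average W i j * Dz' j - I0)).
  rewrite !addrA; congr (_ - _).
  have -> : n%:R^-1 * \sum_j cell_average W i j * Dz' j =
     (n%:R * alpha)^-1 * \sum_j alpha * cell_average W i j * Dz' j.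
    under [in RHS]eq_bigr do rewrite -mulrA.
    by rewrite -mulr_sumr invfM mulrA -[n%:R^-1 / alpha * alpha]mulrA mulVf ?mulr1 ?gt_eqF.
  rewrite -!mulrDr -!big_split /=; congr (_ * _); apply: eq_bigr => j _; ring.
apply: le_trans (ler_normD _ _) _.
apply: le_trans (lerD e1 (le_trans (ler_normD _ _) (lerD e2 e3))) _.
by rewrite le_eqVlt; apply/orP; left; apply/eqP; ring.
Qed.

End consistency.

(** The constant 5 L is the Lipschitz constant L of f plus 4 L for the coupling
with degrees at most 2 n alpha. *)
Lemma sampled_close_to_continuum (R : realType) (n : nat) (alpha L T kappa : R)
    (W : R * R -> R) (f D eta : R -> R) (theta : R -> R -> R)
    (a : 'I_n -> 'I_n -> bool) (u : R -> 'I_n -> R) :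
  (0 < n)%N -> 0 < alpha -> 0 < L -> 0 <= kappa ->
  (forall x y, `|f x - f y| <= L * `|x - y|) ->
  (forall x y, `|D x - D y| <= L * `|x - y|) ->
  CDS_solution W f D eta theta -> SDS_solution alpha a f D eta u ->
  (forall i, \sum_j (a i j)%:R <= 2 * (n%:R * alpha)) ->
  (forall (t : R) i, 0 < t < T ->
    `|(n%:R * alpha)^-1 * \sum_j (a i j)%:R *
        D (theta t (j%:R / n%:R) - theta t (i%:R / n%:R)) -
      \int[lebesgue_measure]_(y in unit_itv)
        (W (i%:R / n%:R, y) * D (theta t y - theta t (i%:R / n%:R)))|
      <= kappa) ->
  forall (t : R) i, 0 <= t <= T ->
    `|u t i - theta t (i%:R / n%:R)| <= 2 * kappa * T * expR (2 * (5 * L) * T).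
Proof.
move=> n_gt0 alpha_gt0 L_gt0 kappa0 f_lip D_lip [_ th0 [dth [_ dthE]]] [u0 du] deg drift.
pose node (i : 'I_n) : R := i%:R / n%:R.
have un i : unit_itv (node i) by exact: node_unit.
have {}du j := half_line_regular (fun t => du t j).
have dv j := half_line_regular (fun t h => (dthE t (node j) h (un j)).1).
apply: (@gronwall_sup R 'I_n T (5 * L) kappa
  (fun t i => u t i - theta t (node i))
  (fun (t : R) i => (f (u t i) + (n%:R * alpha)^-1 *
     \sum_(j < n) (a i j)%:R * D (u t j - u t i)) - dth t (node i))) => //.
- by rewrite mulr_gt0.
- move=> j; have [cu _] := du j; have [cv _] := dv j.
  by move=> t; apply: cvgB; [exact: cu|exact: cv].
- move=> t j /andP[t0 _]; have [_ /(_ t t0) d1] := du j; have [_ /(_ t t0) d2] := dv j.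
  exact: is_deriveB.
- by move=> j; rewrite u0 th0 ?subrr.
move=> t i m tT close.
have ht : half_line t by case/andP: tT => t0 _; rewrite /half_line /= in_itv /= andbT ltW.
rewrite (dthE t (node i) ht (un i)).2.
set I0 := \int[_]_(_ in _) _.
pose S (v : 'I_n -> R) := (n%:R * alpha)^-1 * \sum_(j < n) (a i j)%:R * D (v j - v i).
rewrite (_ : _ - _ = (f (u t i) - f (theta t (node i))) +
   ((S (u t) - S (fun j => theta t (node j))) +
    (S (fun j => theta t (node j)) - I0))); last by rewrite /S; ring.
apply: le_trans (ler_normD _ _) _.
rewrite (_ : 5 * L * m + kappa = L * m + (2 * 2 * L * m + kappa)); last by ring.
apply: lerD.
  by apply: le_trans (f_lip _ _) _; rewrite ler_wpM2l // ltW.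
apply: le_trans (ler_normD _ _) _; apply: lerD; last exact: drift.
rewrite /S -mulrBr -sumrB; under eq_bigr do rewrite -mulrBr.
exact: (coupling_lipschitz n_gt0 alpha_gt0 L_gt0 D_lip (deg i) close).
Qed.

(** The interpolant vanishes at 1, so the bound is asked off this null set. *)
Lemma Linfty_unit_norm_le (R : realType) (g : R -> R) (b : R) :
  (forall x, 0 <= x < 1 -> `|g x| <= b) -> (Linfty_unit_norm g <= b%:E)%E.
Proof.
move=> gb; rewrite /Linfty_unit_norm unlock.
have -> : (0 < mrestr lebesgue_measure (@measurable_unit_itv R) [set: R])%E.
  by rewrite /mrestr setTI /unit_itv lebesgue_measure_itv /= lte01 oppr0 adde0 lte01.
apply/ess_supP; exists (~` `[0, 1[)%classic; split.
- by apply: measurableC; exact: measurable_itv.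
- rewrite /= /mrestr.
  have -> : ~` `[0, 1[ `&` unit_itv = [set (1 : R)].
    apply/seteqP; split => x /=; rewrite /unit_itv /= !in_itv /=.
      move=> [+ /andP[x0 x1]]; rewrite x0 /= => /negP; rewrite -leNgt => x1'.
      by apply/eqP; rewrite eq_le x1 x1'.
    by move=> ->; rewrite ltxx ler01 lexx.
  exact: lebesgue_measure_set1.
- move=> x /= nx x01; apply: nx; rewrite lee_fin; apply: gb.
  by move: x01; rewrite in_itv.
Qed.

Lemma interpolant_close (R : realType) (n : nat) (u : 'I_n -> R) (z : R -> R)
    (b r omega : R) :
  (0 < n)%N -> n%:R^-1 < r ->
  (forall x y, unit_itv x -> unit_itv y -> `|x - y| < r -> `|z x - z y| < omega) ->
  (forall i, `|u i - z (i%:R / n%:R)| <= b) ->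
  (Linfty_unit_norm (fun x => (interpolant u x - z x)%R) <= (b + omega)%:E)%E.
Proof.
move=> n_gt0 nr zu uz; apply: Linfty_unit_norm_le => x x01.
have [i ix] := mem_cell n_gt0 x01; rewrite (interpolant_cell n_gt0 _ ix).
rewrite -[u i - z x](subrKA (z (i%:R / n%:R))).
apply: le_trans (ler_normD _ _) _; apply: lerD; first exact: uz.
apply/ltW/zu; [exact: node_unit|exact: (cell_sub_unit n_gt0 ix)|].
by apply: lt_trans nr; apply: cell_dist ix => //; exact: cell_left.
Qed.

(** Eventually ln n <= (s^2 / 16) n alpha^3 <= (s^2 / 16) n alpha, so that the
exponential is at most n^-2, which beats the factor n of the union bound. *)
Lemma chernoff_tail_vanishes (R : realType) (alpha : nat -> R) (M s delta : R) :
  (forall n, (0 < n)%N -> 0 < alpha n <= 1) ->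
  (ln n%:R / n%:R) / alpha n ^+ 3 @[n --> \oo] --> (0 : R) ->
  0 <= M -> 0 < s -> 0 < delta ->
  \forall n \near \oo,
    M * n%:R * (2 * expR (- (n%:R * alpha n * s ^+ 2 / 8))) <= delta.
Proof.
move=> a01 rate M0 s0 d0.
have s16 : 0 < s ^+ 2 / 16 by rewrite divr_gt0 ?exprn_gt0.
near=> n.
have n_gt0 : (0 < n)%N by near: n; exact: nbhs_infty_gt.
have n0 : 0 < n%:R :> R by rewrite ltr0n.
have /andP[a0 a1] := a01 n n_gt0.
have : ln n%:R / n%:R / alpha n ^+ 3 <= s ^+ 2 / 16.
  apply: le_trans (ler_norm _) _; near: n.
  by move/cvgr0_norm_le : rate; apply.
rewrite ler_pdivrMr ?exprn_gt0 // ler_pdivrMr // => lnn.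
have a3 : alpha n ^+ 3 <= alpha n.
  by rewrite -[leRHS]expr1 ler_wiXn2l // ltW.
have {}lnn : 2 * ln n%:R <= n%:R * alpha n * s ^+ 2 / 8.
  have := ler_wpM2l (mulr_ge0 (ltW s16) (ltW n0)) a3.
  lra.
have H : expR (- (n%:R * alpha n * s ^+ 2 / 8)) <= (n%:R ^+ 2)^-1.
  rewrite expRN lef_pV2 ?posrE ?expR_gt0 ?exprn_gt0 //.
  have -> : n%:R ^+ 2 = expR (2 * ln n%:R) :> R by rewrite expRM_natl lnK ?posrE.
  by rewrite ler_expR.
apply: (@le_trans _ _ (M * n%:R * (2 * (n%:R ^+ 2)^-1))).
  by rewrite ler_wpM2l ?mulr_ge0 // ?ler_wpM2l // ltW.
have -> : M * n%:R * (2 * (n%:R ^+ 2)^-1) = 2 * M / n%:R by field; rewrite gt_eqF.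
rewrite ler_pdivrMr // [delta * _]mulrC -ler_pdivrMr //; near: n.
exact: nbhs_infty_ger.
Unshelve. all: by end_near.
Qed.

(** * Convergence in probability *)

(** The deterministic half of the proof.  The coefficient indexed by None is the
constant 1 and controls the degrees; the others are the couplings along the
continuum solution at the times tau of the grid. *)
Lemma deviation_implies_close (R : realType) (n : nat) (alpha L T omega r : R)
    (N : nat) (tau : 'I_N -> R)
    (W : R * R -> R) (f D eta : R -> R) (theta : R -> R -> R)
    (a : 'I_n -> 'I_n -> bool) (u : R -> 'I_n -> R) :
  (0 < n)%N -> 0 < alpha -> 0 < L -> 0 <= omega <= 1 -> n%:R^-1 < r ->
  (forall x y, `|f x - f y| <= L * `|x - y|) ->
  (forall x y, `|D x - D y| <= L * `|x - y|) ->
  (forall x, `|D x| <= 1) ->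
  {within unit_itv `*` unit_itv, continuous W} ->
  (forall x y, unit_itv x -> unit_itv y -> unit_itv (W (x, y))) ->
  (forall p q, (unit_itv `*` unit_itv) p -> (unit_itv `*` unit_itv) q ->
     ball p r q -> `|W p - W q| < omega) ->
  CDS_solution W f D eta theta -> SDS_solution alpha a f D eta u ->
  (forall (t : R), 0 <= t <= T -> exists k, forall x y,
     unit_itv x -> unit_itv y -> `|x - y| < r ->
     `|theta t x - theta (tau k) y| < omega) ->
  (forall (t : R), 0 <= t <= T -> forall x y,
     unit_itv x -> unit_itv y -> `|x - y| < r ->
     `|theta t x - theta t y| < omega) ->
  (forall (k : option 'I_N) i,
     `|\sum_j ((a i j)%:R - alpha * cell_average W i j) *
        (if k is Some k' then
           D (theta (tau k') (j%:R / n%:R) - theta (tau k') (i%:R / n%:R))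
         else 1)| <= omega * (n%:R * alpha)) ->
  forall (t : R), 0 <= t <= T ->
    (Linfty_unit_norm (fun x => (interpolant (u t) x - theta t x)%R) <=
     (omega * (2 * (6 * L + 2) * T * expR (2 * (5 * L) * T) + 1))%:E)%E.
Proof.
move=> n_gt0 alpha_gt0 L_gt0 /andP[om0 om1] nr f_lip D_lip D1 cW W01 Wu CDS SDS
  grid thu dev t tT.
have na0 : 0 < n%:R * alpha by rewrite mulr_gt0 ?ltr0n.
have deg i : \sum_j (a i j)%:R <= 2 * (n%:R * alpha).
  have := dev None i; under eq_bigr do rewrite mulr1.
  rewrite sumrB ler_norml => /andP[_ H].
  have : \sum_j alpha * cell_average W i j <= n%:R * alpha.
    rewrite mulr_natl -[X in _ *+ X]card_ord -sumr_const; apply: ler_sum => j _.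
    apply: ler_piMr; first exact: ltW.
    by case/andP: (cell_average_unit n_gt0 W01 i j).
  have : omega * (n%:R * alpha) <= 1 * (n%:R * alpha) by rewrite ler_wpM2r // ltW.
  lra.
have kappa0 : 0 <= (6 * L + 2) * omega by rewrite mulr_ge0 // addr_ge0 // mulr_ge0 // ltW.
have drift (s : R) i : 0 < s < T ->
    `|(n%:R * alpha)^-1 * \sum_j (a i j)%:R *
        D (theta s (j%:R / n%:R) - theta s (i%:R / n%:R)) -
      \int[lebesgue_measure]_(y in unit_itv)
        (W (i%:R / n%:R, y) * D (theta s y - theta s (i%:R / n%:R)))|
      <= (6 * L + 2) * omega.
  move=> /andP[s0 sT]; have sT' : 0 <= s <= T by rewrite !ltW.
  have [k thk] := grid s sT'.
  apply: (vector_field_consistency n_gt0 alpha_gt0 L_gt0 D_lip D1 cW W01 nr Wu _ thk) => //.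
    have [cth _ _] := CDS; apply: (within_continuous_slice _ cth).
    by rewrite /half_line /= in_itv /= ltW.
  exact: (dev (Some k) i).
have close := sampled_close_to_continuum n_gt0 alpha_gt0 L_gt0 kappa0
  f_lip D_lip CDS SDS deg drift.
apply: le_trans (interpolant_close n_gt0 nr (thu t tT) (fun i => close t i tT)) _.
rewrite lee_fin le_eqVlt; apply/orP; left; apply/eqP; ring.
Qed.

Theorem theorem2p2 (R : realType)
  (W : R * R -> R)
  (W_continuous : {within unit_itv `*` unit_itv, continuous W})
  (W_range : forall x y, unit_itv x -> unit_itv y -> unit_itv (W (x, y)))
  (W_sym : forall x y, unit_itv x -> unit_itv y -> W (x, y) = W (y, x))
  (eta : R -> R) (eta_continuous : {within unit_itv, continuous eta})
  (f : R -> R) (f_lipschitz : lipschitz f) (f_periodic : periodic f (2 * pi))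
  (D : R -> R) (D_lipschitz : lipschitz D) (D_periodic : periodic D (2 * pi))
  (D_max : (forall x, `|D x| <= 1) /\ (exists x, `|D x| = 1))
  (alpha : nat -> R)
  (alpha_range : forall n, (0 < n)%N -> 0 < alpha n <= 1)
  (alpha_rate : (ln n%:R / n%:R) / alpha n ^+ 3 @[n --> \oo] --> (0 : R))
  (theta : R -> R -> R) (theta_CDS : CDS_solution W f D eta theta)
  (d : nat -> measure_display) (Omega : forall n, measurableType (d n))
  (P : forall n, probability (Omega n) R)
  (A : forall n, 'I_n -> 'I_n -> {RV (P n) >-> bool})
  (A_network : forall n, (0 < n)%N -> W_random_network W (alpha n) (A n))
  (thetan : forall n, Omega n -> R -> 'I_n -> R)
  (thetan_SDS : forall n (w : Omega n), (0 < n)%N ->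
     SDS_solution (alpha n) (fun i j => A n i j w) f D eta (thetan n w))
  (delta epsilon T : R) (delta_gt0 : 0 < delta) (epsilon_gt0 : 0 < epsilon)
  (T_gt0 : 0 < T) :
  exists nbar : nat, forall n : nat, (nbar < n)%N ->
    let good := [set w : Omega n | forall t, 0 <= t <= T ->
      (Linfty_unit_norm
         (fun x => (interpolant (thetan n w t) x - theta t x)%R)
       < epsilon%:E)%E] in
    measurable good /\ ((1 - delta)%:E <= P n good)%E.
Proof.
have compact_unit : compact (unit_itv : set R) by exact: segment_compact.
have [L [L_gt0 f_lip D_lip]] : exists L : R, [/\ 0 < L,
    forall x y, `|f x - f y| <= L * `|x - y| &
    forall x y, `|D x - D y| <= L * `|x - y|].
  have : \forall L \near (+oo : set_system R), [/\ 0 < L,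
    forall x y, `|f x - f y| <= L * `|x - y| &
    forall x y, `|D x - D y| <= L * `|x - y|].
    near=> L; split; near: L.
    - exact: nbhs_pinfty_gt.
    - exact: lipschitz_constant.
    - exact: lipschitz_constant.
  by move=> /(@filter_ex _ _ _) [L HL]; exists L.
(* omega is the tolerance for all moduli of continuity and for the random
   deviations; the total error is omega Q. *)
pose Q := 2 * (6 * L + 2) * T * expR (2 * (5 * L) * T) + 1.
have Q_gt0 : 0 < Q.
  by rewrite ltr_wpDl // !mulr_ge0 ?expR_ge0 // ?addr_ge0 ?mulr_ge0 // ltW.
pose omega := Num.min 1 (epsilon / (2 * Q)).
have omega_gt0 : 0 < omega by rewrite lt_min ltr01 divr_gt0 // mulr_gt0.
have omega_le1 : omega <= 1 by rewrite ge_min lexx.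
have omegaQ : omega * Q < epsilon.
  apply: (@le_lt_trans _ _ (epsilon / (2 * Q) * Q)).
    by rewrite ler_wpM2r ?(ltW Q_gt0) // ge_min lexx orbT.
  by rewrite invfM mulrA divfK ?gt_eqF // ltr_pdivrMr // ltr_pMr // ltr1n.
have [rW rW_gt0 W_unif] := compact_uniformly_continuous
  (compact_setX compact_unit compact_unit) W_continuous omega_gt0.
(* The times T1 k / N with k < N come within T1 / N of every point of [0, T]
   because T < T1. *)
pose T1 := T + 1; have T1_gt0 : 0 < T1 by rewrite addr_gt0.
pose strip : set (R * R) := `[0, T1] `*` unit_itv.
have theta_continuous : {within strip, continuous (fun p : R * R => theta p.1 p.2)}.
  have [ctheta _ _] := theta_CDS; apply: continuous_subspaceW ctheta.
  move=> [t x] [/=]; rewrite in_itv /= => /andP[t0 _] ux; split => //=.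
  by rewrite /half_line /= in_itv /= t0.
have [rth rth_gt0 theta_unif] := compact_uniformly_continuous
  (compact_setX (segment_compact (a := 0) (b := T1)) compact_unit)
  theta_continuous omega_gt0.
pose r := Num.min rW rth.
have r_gt0 : 0 < r by rewrite lt_min rW_gt0.
pose N := (Num.truncn (T1 / r)).+1.
have N_gt0 : 0 < N%:R :> R by rewrite ltr0n.
have T1N : T1 / N%:R < r.
  by rewrite ltr_pdivrMr // mulrC -ltr_pdivrMr // truncnS_gt.
pose tau (k : 'I_N) : R := T1 * (k%:R / N%:R).
have tau_itv k : 0 <= tau k <= T1.
  rewrite /tau mulr_ge0 ?divr_ge0 ?(ltW T1_gt0) //= -[leRHS]mulr1.
  by rewrite ler_wpM2l ?(ltW T1_gt0) // ler_pdivrMr // mul1r ler_nat ltnW.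
have theta_close (t t' x y : R) : 0 <= t <= T1 -> 0 <= t' <= T1 -> `|t - t'| < r ->
    unit_itv x -> unit_itv y -> `|x - y| < r -> `|theta t x - theta t' y| < omega.
  move=> tT t'T tt' ux uy xy.
  apply: (theta_unif (t, x) (t', y)) => /=; rewrite ?in_itv //.
  by split; rewrite /ball /= ; [apply: lt_le_trans tt' _|apply: lt_le_trans xy _];
    rewrite ge_min lexx ?orbT.
have grid (t : R) : 0 <= t <= T -> exists k, `|t - tau k| < r.
  move=> /andP[t0 tT].
  have [|k] := @mem_cell R N isT (t / T1).
    by rewrite divr_ge0 ?(ltW T1_gt0) //= ltr_pdivrMr // mul1r /T1; lra.
  move=> kt; have := cell_dist kt (cell_left (isT : (0 < N)%N) k).
  exists k; apply: lt_trans T1N.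
  have -> : t - tau k = T1 * (t / T1 - k%:R / N%:R).
    by rewrite mulrBr [T1 * (t / T1)]mulrC divfK ?gt_eqF.
  by rewrite normrM gtr0_norm // ltr_pM2l.
have [n0 tail] : exists n0, forall n, (n0 <= n)%N ->
    #|{: option 'I_N}|%:R * n%:R *
      (2 * expR (- (n%:R * alpha n * omega ^+ 2 / 8))) <= delta /\ n%:R^-1 < r.
  have : \forall n \near \oo, #|{: option 'I_N}|%:R * n%:R *
      (2 * expR (- (n%:R * alpha n * omega ^+ 2 / 8))) <= delta /\ n%:R^-1 < r.
    near=> n; split; near: n; first exact: chernoff_tail_vanishes.
    near=> m; have rm : r^-1 < m%:R by near: m; exact: nbhs_infty_gtr.
    by rewrite -[r]invrK ltf_pV2 // posrE ?invr_gt0 // (lt_trans _ rm) ?invr_gt0.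
  by case=> n0 _ H; exists n0 => n /H.
exists n0 => n n0n; have n_gt0 : (0 < n)%N by exact: leq_ltn_trans n0n.
have [tailn nr] := tail n (ltnW n0n).
have /andP[alpha_gt0 alpha_le1] := alpha_range n n_gt0.
set good := [set w | _]%classic.
have AW := A_network n n_gt0.
have mgood : measurable good.
  apply: (@measurable_of_bool_family _ _ _ _ _ (fun ij : 'I_n * 'I_n => A n ij.1 ij.2)).
  move=> w w' ww' gw t tT.
  have aE : (fun i j => A n i j w) = (fun i j => A n i j w').
    by apply/funext => i; apply/funext => j; exact: (ww' (i, j)).
  have := thetan_SDS n w n_gt0; rewrite aE => uw.
  have /andP[t0 _] := tT.
  rewrite -(SDS_solution_unique n_gt0 alpha_gt0 L_gt0 D_lip f_lip uw
    (thetan_SDS n w' n_gt0) t0).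
  exact: gw.
split => //.
pose c (k : option 'I_N) (i j : 'I_n) : R := if k is Some k' then
  D (theta (tau k') (j%:R / n%:R) - theta (tau k') (i%:R / n%:R)) else 1.
have c1 k i j : `|c k i j| <= 1.
  by case: k => [k|] /=; [exact: (D_max.1)|rewrite normr1].
have W01 := cell_average_unit n_gt0 W_range.
have p01 (i j : 'I_n) : 0 <= alpha n * cell_average W i j <= 1.
  have /andP[w0 w1] := W01 i j.
  by rewrite mulr_ge0 ?(ltW alpha_gt0) //= mulr_ile1 // ltW.
have pm (i : 'I_n) : \sum_j alpha n * cell_average W i j <= n%:R * alpha n.
  rewrite mulr_natl -[X in _ *+ X]card_ord -sumr_const; apply: ler_sum => j _.
  by apply: ler_piMr; [exact: ltW|case/andP: (W01 i j)].
have omega02 : 0 <= omega <= 2 by rewrite (ltW omega_gt0) (le_trans omega_le1) // ler1n.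
have := network_deviation AW p01 pm c1 omega02.
set E := [set w | _]%classic => PE.
apply: (@le_trans _ _ (P n E)).
  by apply: le_trans PE; rewrite lee_fin lerD2l lerN2.
apply: le_measure; rewrite ?inE //.
  apply: (@measurable_of_bool_family _ _ _ _ _ (fun ij : 'I_n * 'I_n => A n ij.1 ij.2)).
  move=> w w' ww' Ew k i; have := Ew k i.
  by under eq_bigr do rewrite (ww' (i, _)).
move=> w Ew t tT; apply: le_lt_trans (_ : _ <= (omega * Q)%:E)%E _; last first.
  by rewrite lte_fin.
have tT1 (s : R) : 0 <= s <= T -> 0 <= s <= T1.
  by move=> /andP[-> /le_trans]; apply; rewrite /T1 lerDl.
apply: (deviation_implies_close (r := r) (tau := tau) n_gt0 alpha_gt0 L_gt0 _ nr
  f_lip D_lip D_max.1 W_continuous W_range _ theta_CDS (thetan_SDS n w n_gt0) _ _ Ew tT).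
- by rewrite ltW.
- move=> p q up uq pq; apply: W_unif => //; apply: le_ball pq.
  by rewrite ge_min lexx.
- move=> s sT; have [k sk] := grid s sT; exists k => x y ux uy xy.
  by apply: theta_close => //; exact: tT1.
- by move=> s sT x y ux uy xy; apply: theta_close; rewrite ?subrr ?normr0 ?tT1.
Unshelve. all: by end_near.
Qed.
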